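(* Let $(L,\mathcal{U})$ be a compact zero-dimensional linear topological residuated lattice. Then a filter $G$ of $L$ is open if and only if $G$ is closed and of finite index.
   Context: A residuated lattice is an algebra $(L,\wedge,\vee,\odot,\rightarrow,0,1)$ such that $(L,\wedge,\vee,0,1)$ is a bounded lattice, $(L,\odot,1)$ is a commutative monoid, and $x\odot y\le z$ iff $x\le y\rightarrow z$. A topological residuated lattice is a residuated lattice with a topology making $\wedge,\vee,\odot,\rightarrow$ continuous. A topology on $L$ is linear if it has a base $\beta$ such that every member of $\beta$ containing $1$ is a filter; it is zero-dimensional if it has a base of clopen sets. A filter is a nonempty subset closed under $\odot$ and upward closed; for a filter $G$, $x/G$ is the class of $x$ under the congruence $\theta_G=\{(x,y):(x\rightarrow y)\odot(y\rightarrow x)\in G\}$, and $G$ has finite index if the quotient $L/G$ is finite. *)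

(* Defs.v *)
From HB Require Import structures.
From mathcomp Require Import all_boot all_order.
From mathcomp Require Import boolp classical_sets functions cardinality.
From mathcomp Require Import topology_structure product_topology compact.

(* [order_topology] is deliberately not imported: it declares joins of order  *)
(* and topological structures (with the order topology) that prevent          *)
(* Hierarchy Builder from declaring the topological structure below.          *)

Set Implicit Arguments.
Unset Strict Implicit.
Unset Printing Implicit Defensive.

Import Order.TTheory.

Local Open Scope classical_set_scope.

HB.mixin Record isResiduatedLattice (d : Order.disp_t) L
    of Order.TBLattice d L := {
  rlmul : L -> L -> L;
  rlimp : L -> L -> L;
  rlmulA : associative rlmul;
  rlmulC : commutative rlmul;
  rlmul1x : left_id (\top%O : L) rlmul;
  rl_residuation : forall x y z : L,
    (rlmul x y <= z)%O = (x <= rlimp y z)%O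
}.

#[short(type="residuatedLatticeType")]
HB.structure Definition ResiduatedLattice (d : Order.disp_t) :=
  {L of isResiduatedLattice d L & Order.TBLattice d L}.

HB.mixin Record isTopologicalResiduatedLattice (d : Order.disp_t) L
    of ResiduatedLattice d L & Topological L := {
  rlmeet_continuous : continuous (fun p : L * L => Order.meet p.1 p.2);
  rljoin_continuous : continuous (fun p : L * L => Order.join p.1 p.2);
  rlmul_continuous : continuous (fun p : L * L => rlmul p.1 p.2);
  rlimp_continuous : continuous (fun p : L * L => rlimp p.1 p.2)
}.

#[short(type="topResiduatedLatticeType")]
HB.structure Definition TopologicalResiduatedLattice (d : Order.disp_t) :=
  {L of isTopologicalResiduatedLattice d L & ResiduatedLattice d L
      & Topological L}.

(* Filters of a residuated lattice; not to be confused with the filters of    *)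
(* sets ([Filter]) used for convergence.                                      *)
Definition rl_filter (d : Order.disp_t) (L : residuatedLatticeType d)
    (F : set L) : Prop :=
  [/\ F !=set0,
      forall x y, F x -> F y -> F (rlmul x y)
    & forall x y, F x -> (x <= y)%O -> F y].

Definition rl_theta (d : Order.disp_t) (L : residuatedLatticeType d)
    (G : set L) : set (L * L) :=
  [set p | G (rlmul (rlimp p.1 p.2) (rlimp p.2 p.1))].

Definition rl_class (d : Order.disp_t) (L : residuatedLatticeType d)
    (G : set L) (x : L) : set L :=
  [set y | rl_theta G (x, y)].

Definition rl_quotient (d : Order.disp_t) (L : residuatedLatticeType d)
    (G : set L) : set (set L) :=
  range (rl_class G).

Definition finite_index (d : Order.disp_t) (L : residuatedLatticeType d)
    (G : set L) : Prop :=
  finite_set (rl_quotient G).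

Definition linear_topology (d : Order.disp_t)
    (L : topResiduatedLatticeType d) : Prop :=
  exists2 B : set (set L), basis B &
    forall U, B U -> U (\top%O : L) -> rl_filter U.

(* The library's [zero_dimensional] only asks that distinct points be         *)
(* separated by clopen sets, which differs from having a base of clopen sets. *)
Definition has_clopen_base (T : topologicalType) : Prop :=
  exists2 B : set (set T), basis B & forall U, B U -> clopen U.

(* Main.v *)
(** Each class [x/G] is the preimage of [G] under the continuous map
[y |-> (x -> y) * (y -> x)], so it is open (closed) as soon as [G] is. The
classes partition [L] and [G] is a union of classes. If [G] is open, the open
partition of the compact space [L] into classes is finite, and the complement
of [G] is open, being a union of classes. If [G] is closed of finite index, the
complement of [G] is a finite union of closed classes. *)

From HB Require Import structures.
Require Import Defs.
From mathcomp Require Import all_boot all_order.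
From mathcomp Require Import boolp classical_sets functions cardinality topology_structure.
From mathcomp Require Import filter product_topology compact.

Import Order.TTheory.

Local Open Scope classical_set_scope.

Section ResiduatedLatticeTheory.
Context {d : Order.disp_t} {L : residuatedLatticeType d}.
Implicit Types (x y z : L) (G : set L).

Lemma rlmulx1 x : rlmul x \top%O = x.
Proof. by rewrite rlmulC rlmul1x. Qed.

(** By residuation it suffices that [y] lies below [rlimp x (rlmul x z)], and [z] already does. *)
Lemma le_rlmul2l x y z : (y <= z)%O -> (rlmul x y <= rlmul x z)%O.
Proof.
move=> yz; rewrite rlmulC rl_residuation (le_trans yz)//.
by rewrite -rl_residuation rlmulC.
Qed.

Lemma rlmul_lel x y : (rlmul x y <= x)%O.
Proof. by rewrite -[leRHS]rlmulx1 le_rlmul2l// lex1. Qed.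

Lemma rlmul_ler x y : (rlmul x y <= y)%O.
Proof. by rewrite rlmulC rlmul_lel. Qed.

Lemma rlimp_mul_le x y : (rlmul (rlimp x y) x <= y)%O.
Proof. by rewrite rl_residuation. Qed.

(** After residuation, this is modus ponens applied twice: from [x] to [y], then from [y] to [z]. *)
Lemma rlimp_trans x y z : (rlmul (rlimp x y) (rlimp y z) <= rlimp x z)%O.
Proof.
rewrite -rl_residuation (rlmulC (rlimp x y)) -rlmulA.
apply: le_trans (rlimp_mul_le y z).
exact/le_rlmul2l/rlimp_mul_le.
Qed.

Lemma rlimp_refl x : rlimp x x = \top%O.
Proof.
by apply/eqP; rewrite -le1x -rl_residuation rlmul1x.
Qed.

Lemma rl_filter_top G : rl_filter G -> G \top%O.
Proof.
by case=> -[x Gx] _ up; apply: up Gx _; exact: lex1.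
Qed.

(** A product lies below both of its factors. This splits [rl_theta] into its two implications. *)
Lemma rl_filter_mulP G x y : rl_filter G -> G (rlmul x y) <-> G x /\ G y.
Proof.
case=> _ mul up; split=> [Gxy|[]]; last exact: mul.
by split; apply: up Gxy _; [exact: rlmul_lel|exact: rlmul_ler].
Qed.

Lemma rl_thetaP G x y : rl_filter G ->
  rl_theta G (x, y) <-> G (rlimp x y) /\ G (rlimp y x).
Proof. exact: rl_filter_mulP. Qed.

Lemma rl_theta_refl G x : rl_filter G -> rl_theta G (x, x).
Proof.
by move=> GF; rewrite rl_thetaP// rlimp_refl; split; exact: rl_filter_top.
Qed.

Lemma rl_theta_sym G x y : rl_theta G (x, y) -> rl_theta G (y, x).
Proof. by rewrite /rl_theta /= rlmulC. Qed.

Lemma rl_theta_trans G x y z : rl_filter G ->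
  rl_theta G (x, y) -> rl_theta G (y, z) -> rl_theta G (x, z).
Proof.
move=> GF; rewrite !rl_thetaP// => -[xy yx] [yz zy]; case: GF => _ mul up.
by split; [apply: up (rlimp_trans x y z)|apply: up (rlimp_trans z y x)];
  exact: mul.
Qed.

Lemma rl_class_eq G x y : rl_filter G ->
  rl_class G x y -> rl_class G x = rl_class G y.
Proof.
move=> GF xy; apply/seteqP; split=> z.
  by apply: rl_theta_trans => //; exact: rl_theta_sym.
exact: rl_theta_trans.
Qed.

Lemma rl_filter_theta G x y : rl_filter G -> rl_theta G (x, y) -> G x -> G y.
Proof.
move=> GF /(rl_thetaP _ _ _ GF)[xy _] Gx; case: GF => _ mul up.
by apply: up (rlimp_mul_le x y); exact: mul.
Qed.

(** A class that meets [G] lies inside [G]. The union runs over classes rather than points, so that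
    finite index makes it a finite union. *)
Lemma setC_rl_filter G : rl_filter G ->
  ~` G = \bigcup_(C in rl_class G @` (~` G)) C.
Proof.
move=> GF; rewrite bigcup_image; apply/seteqP; split=> [x nGx|y [x nGx xy] Gy].
  by exists x => //; exact: rl_theta_refl.
by apply/nGx/(rl_filter_theta _ _ _ GF _ Gy); exact: rl_theta_sym.
Qed.

End ResiduatedLatticeTheory.

Section TopologicalResiduatedLatticeTheory.
Context {d : Order.disp_t} {L : topResiduatedLatticeType d}.
Implicit Types (x : L) (G : set L).

Lemma rl_biimp_continuous x :
  continuous (fun y : L => rlmul (rlimp x y) (rlimp y x)).
Proof.
move=> y.
have xy : (fun z : L => rlimp x z) @ y --> rlimp x y.
  apply: (cvg_comp (fun z : L => (x, z)) _ _ (rlimp_continuous (x, y))).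
  by apply: cvg_pair; [exact: cvg_cst|exact: cvg_id].
have yx : (fun z : L => rlimp z x) @ y --> rlimp y x.
  apply: (cvg_comp (fun z : L => (z, x)) _ _ (rlimp_continuous (y, x))).
  by apply: cvg_pair; [exact: cvg_id|exact: cvg_cst].
apply: (cvg_comp (fun z : L => (rlimp x z, rlimp z x)) _ _
  (rlmul_continuous (rlimp x y, rlimp y x))).
exact: cvg_pair.
Qed.

Lemma open_rl_class G x : open G -> open (rl_class G x).
Proof. by apply: open_comp => y _; exact: rl_biimp_continuous. Qed.

Lemma closed_rl_class G x : closed G -> closed (rl_class G x).
Proof. by apply: preimage_closed => y _; exact: rl_biimp_continuous. Qed.

Lemma open_rl_filter_closed G : rl_filter G -> open G -> closed G.
Proof.
move=> GF Go; rewrite -openC setC_rl_filter//.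
by apply: bigcup_open => _ [x _ <-]; exact: open_rl_class.
Qed.

Lemma compact_cover_setT : compact [set: L] -> cover_compact [set: L].
Proof.
(* [compact_cover] is stated for pointed spaces; the top element serves as the point, and the
   topology is unchanged. *)
pose P := isPointed.Build L \top%O.
pose T : ptopologicalType := HB.pack (L : Type) L P.
by have := @compact_cover T; move=> /(congr1 (fun f => f setT)) <-.
Qed.

Lemma open_rl_filter_finite_index G : compact [set: L] ->
  rl_filter G -> open G -> finite_index G.
Proof.
move=> Lc GF Go.
(* The cover by classes is indexed by the points of [L], so the finite subcover yields a finite set
   [D] of representatives. *)
have [|x _|D _ LD] := compact_cover_setT Lc L [set: L] (rl_class G).
- by move=> x _; exact: open_rl_class.
- by exists x => //; exact: rl_theta_refl.
apply: (sub_finite_set _ (finite_image (rl_class G) (finite_fset D))).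
move=> _ [x _ <-]; have [y yD yx] := LD x I.
by exists y => //; exact: rl_class_eq.
Qed.

Lemma closed_finite_index_open G : rl_filter G ->
  closed G -> finite_index G -> open G.
Proof.
move=> GF Gc Gfin; rewrite -[G]setCK openC setC_rl_filter//.
apply: closed_bigcup => [|_ [x _ <-]]; last exact: closed_rl_class.
(* The classes of points outside [G] form a subset of the finite quotient. *)
exact/sub_finite_set/Gfin/image_subset.
Qed.

End TopologicalResiduatedLatticeTheory.

Theorem theorem7p20 (d : Order.disp_t) (L : topResiduatedLatticeType d)
  (L_compact : compact [set: L])
  (L_zero_dimensional : has_clopen_base L)
  (L_linear : linear_topology L)
  (G : set L) (G_filter : rl_filter G) :
  open G <-> (closed G /\ finite_index G).
Proof.
split=> [Go|[Gc Gfin]]; last exact: closed_finite_index_open.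
split; first exact: open_rl_filter_closed.
exact: open_rl_filter_finite_index.
Qed.
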